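(* The kernel $K$ of $U+I:M(\mathit{odd})\rightarrow M(\mathit{odd})$ is a subspace of $N2$. Consequently, if $g_{n}$ ($n\ge 0$, $n\equiv 0$ or $2 \bmod 6$) is a $\mathbb{Z}/2$-basis of $\ker\varphi$ with $g_{n}$ of degree $n$, and $f_{n}=(r^{2}+r)g_{n}(r^{2})$, then each $f_{n}$ is in $N2$.
   Context: Work in the polynomial ring $\mathbb{Z}/2[r]$. Let $F=r(r+1)^{5}$ and $G=r^{5}(r+1)$. Since $1,r,r^2,r^3,r^4,r^5$ is a basis of $\mathbb{Z}/2[r]$ over $\mathbb{Z}/2[G]$, there is a unique $\mathbb{Z}/2$-linear map $U:\mathbb{Z}/2[r]\to\mathbb{Z}/2[r]$ satisfying $U(Gf)=F\,U(f)$ for all $f$ and taking $1,r,r^{2},r^{3},r^{4},r^{5}$ to $1,\ r,\ r^{2},\ r^{3}+r^{2}+r,\ r^{4},\ r^{5}+r^{4}+r$ respectively. $I$ is the identity map. $M(\mathit{odd})\subset\mathbb{Z}/2[r]$ is the space of all $(r^{2}+r)g(r^{2})$ with $g\in\mathbb{Z}/2[t]$; $U$ stabilizes $M(\mathit{odd})$. Let $u_{0}=F+G$, $u_{1}=(F+G)^{3}+G$, $u_{2}=G$, $u_{4}=(F+G)^{2}G$, $u_{5}=(F+G)^{4}G+(F+G)FG$. $N2$ is the $\mathbb{Z}/2[G^{2}]$-submodule of $M(\mathit{odd})$ generated by $u_{0},u_{1},u_{2},u_{4},u_{5}$ (it is free of rank 5). The polynomials $C_{n}\in \mathbb{Z}/2[t]$,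 $n\ge 0$, are defined by $C_{n+6}=C_{n+5}+(t^{6}+t^{5}+t^{2}+t)C_{n}+t^{n}(t^{2}+t)$, with $C_{0}=0$, $C_{1}=C_{2}=1$, $C_{3}=t$, $C_{4}=t^{2}$, $C_{5}=t^{4}+t^{2}+t$. The map $\varphi:\mathbb{Z}/2[t]\to\mathbb{Z}/2[t]$ is the $\mathbb{Z}/2$-linear map taking $t^{k}$ to $C_{k}$ for all $k\ge 0$; its kernel has a basis consisting of elements $g_n$ of degree $n$, one for each $n\equiv 0$ or $2\bmod 6$. *)

(* Defs.v *)
(* Both polynomial rings, Z/2[r] and Z/2[t], are {poly 'F_2}; the variables r
   and t are both written 'X. *)
From HB Require Import structures.
From mathcomp Require Import all_boot all_order all_algebra.
Set Implicit Arguments.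
Unset Strict Implicit.
Unset Printing Implicit Defensive.
Import GRing.Theory.
Local Open Scope ring_scope.

Notation F2X := {poly 'F_2}.

Definition F : F2X := 'X * ('X + 1) ^+ 5.
Definition G : F2X := 'X ^+ 5 * ('X + 1).

Definition is_U (U : {linear F2X -> F2X}) : Prop :=
  (forall f, U (G * f) = F * U f) /\
  [/\ U 1 = 1, U 'X = 'X & U 'X^2 = 'X^2] /\
  [/\ U 'X^3 = 'X^3 + 'X^2 + 'X,
      U 'X^4 = 'X^4
    & U 'X^5 = 'X^5 + 'X^4 + 'X].

Definition Modd (f : F2X) : Prop :=
  exists g : F2X, f = ('X^2 + 'X) * (g \Po 'X^2).

Definition K (U : {linear F2X -> F2X}) (f : F2X) : Prop :=
  Modd f /\ U f + f = 0.

Definition u0 : F2X := F + G.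
Definition u1 : F2X := (F + G) ^+ 3 + G.
Definition u2 : F2X := G.
Definition u4 : F2X := (F + G) ^+ 2 * G.
Definition u5 : F2X := (F + G) ^+ 4 * G + (F + G) * F * G.

(* c \Po G ^+ 2, for c a polynomial over 'F_2, is the general element of
   'F_2[G^2]. *)
Definition N2 (f : F2X) : Prop :=
  exists c0 c1 c2 c4 c5 : F2X,
    f = (c0 \Po G ^+ 2) * u0 + (c1 \Po G ^+ 2) * u1 + (c2 \Po G ^+ 2) * u2
      + (c4 \Po G ^+ 2) * u4 + (c5 \Po G ^+ 2) * u5.

Fixpoint C (n : nat) : F2X :=
  match n with
  | 0 => 0
  | 1 => 1
  | 2 => 1
  | 3 => 'X
  | 4 => 'X^2
  | 5 => 'X^4 + 'X^2 + 'X
  | (((((m.+1).+1).+1).+1).+1 as m5).+1 =>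
      C m5 + ('X^6 + 'X^5 + 'X^2 + 'X) * C m + 'X^m * ('X^2 + 'X)
  end.

Definition linext (A : nat -> F2X) (p : F2X) : F2X :=
  \sum_(i < size p) p`_i *: A i.

Lemma linextE (A : nat -> F2X) n (p : F2X) : (size p <= n)%N ->
  linext A p = \sum_(i < n) p`_i *: A i.
Proof.
move=> le_pn; rewrite /linext (big_ord_widen n (fun i => p`_i *: A i) le_pn).
rewrite big_mkcond /=; apply: eq_bigr => i _.
by case: ltnP => // le_pi; rewrite nth_default ?scale0r.
Qed.

Lemma linext_is_linear (A : nat -> F2X) : linear (linext A).
Proof.
move=> a p q; set n := maxn (size p) (size q).
have le_pn : (size p <= n)%N by rewrite leq_maxl.
have le_qn : (size q <= n)%N by rewrite leq_maxr.
have le_n : (size (a *: p + q)%R <= n)%N.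
  rewrite (leq_trans (size_polyD _ _)) // geq_max le_qn andbT.
  exact: leq_trans (size_scale_leq _ _) le_pn.
rewrite (linextE _ le_n) (linextE _ le_pn) (linextE _ le_qn).
rewrite scaler_sumr -big_split /=; apply: eq_bigr => i _.
by rewrite coefD coefZ scalerDl scalerA.
Qed.

HB.instance Definition _ A :=
  GRing.isLinear.Build 'F_2 F2X F2X _ (linext A) (linext_is_linear A).

Lemma linextXn A k : linext A 'X^k = A k.
Proof.
rewrite /linext size_polyXn big_ord_recr /= coefXn eqxx scale1r big1 ?add0r //.
by move=> i _; rewrite coefXn ltn_eqF ?scale0r.
Qed.

Definition phi : {linear F2X -> F2X} := linext C.

Lemma phiXn k : phi 'X^k = C k.
Proof. exact: linextXn. Qed.

(* The family g n, n ranging over P, is a basis of the subspace W: finite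
   linear combinations are truncated at an arbitrary bound N on the index. *)
Definition is_basis (P : pred nat) (g : nat -> F2X) (W : F2X -> Prop) : Prop :=
  [/\ forall n, P n -> W (g n),
      forall (N : nat) (c : nat -> 'F_2),
        \sum_(n < N | P n) c n *: g n = 0 ->
        forall n, (n < N)%N -> P n -> c n = 0
    & forall f, W f -> exists (N : nat) (c : nat -> 'F_2),
        f = \sum_(n < N | P n) c n *: g n].

Definition idx02 (n : nat) : bool := (n %% 6 == 0)%N || (n %% 6 == 2)%N.

(* U exists and is unique, so that quantifying over all U with is_U U amounts
   to naming it. *)
Fixpoint Upow (n : nat) : F2X :=
  match n with
  | 0 => 1
  | 1 => 'X
  | 2 => 'X^2
  | 3 => 'X^3 + 'X^2 + 'X
  | 4 => 'X^4
  | 5 => 'X^5 + 'X^4 + 'X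
  | (((((m.+1).+1).+1).+1).+1 as m5).+1 => Upow m5 + F * Upow m
  end.

Lemma GXn n : G * 'X^n = 'X^(n.+4.+2) + 'X^(n.+4.+1) :> F2X.
Proof. by rewrite /G mulrDr mulr1 -exprSr mulrDl -!exprD. Qed.

Lemma linear_eq (f g : {linear F2X -> F2X}) :
  (forall n, f 'X^n = g 'X^n) -> f =1 g.
Proof.
move=> fg p; rewrite -(coefK p) poly_def !linear_sum.
by apply: eq_bigr => i _; rewrite !linearZ /= fg.
Qed.

Lemma F2X_dbl (p : F2X) : p *+ 2 = 0.
Proof.
rewrite -scaler_nat; have -> : 2%:R = 0 :> 'F_2 by apply/val_inj.
by rewrite scale0r.
Qed.

Lemma U_exists : exists U, is_U U.
Proof.
exists (linext Upow : {linear F2X -> F2X}); split.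
  move=> f; rewrite -(coefK f) poly_def mulr_sumr !linear_sum mulr_sumr.
  apply: eq_bigr => i _; rewrite -scalerAr !linearZ /= -scalerAr GXn.
  by rewrite linearD /= !linextXn /= addrAC -mulr2n F2X_dbl add0r.
have U0 : linext Upow 1 = 1 by rewrite -(expr0 'X) linextXn.
have U1 : linext Upow 'X = 'X by rewrite -[X in linext _ X](expr1 'X) linextXn.
by split; split; first [exact: U0 | exact: U1 | exact: linextXn].
Qed.

Lemma U_unique U V : is_U U -> is_U V -> U =1 V.
Proof.
move=> [UG [[U0 U1 U2] [U3 U4 U5]]] [VG [[V0 V1 V2] [V3 V4 V5]]].
apply: linear_eq => n; elim/ltn_ind: n.
do 6![case; rewrite ?expr0 ?expr1 ?(U0, U1, U2, U3, U4, U5)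
                    ?(V0, V1, V2, V3, V4, V5) //].
move=> n IH.
have XE : 'X^(n.+4.+2) = G * 'X^n + 'X^(n.+4.+1) :> F2X.
  by rewrite GXn addrC [X in _ + X]addrC addrA -mulr2n F2X_dbl add0r.
have ltn6 : (n < n.+4.+2)%N by exact: leq_addl 5 n.
by rewrite XE !linearD /= UG VG (IH _ ltn6) IH.
Qed.

(* Main.v *)
Require Import Defs.
From HB Require Import structures.
From mathcomp Require Import all_boot all_order all_algebra ring.
Set Implicit Arguments.
Unset Strict Implicit.
Unset Printing Implicit Defensive.
Import GRing.Theory.
Local Open Scope ring_scope.

(** The involution [swap], r -> r + 1, exchanges F and G, so that
    [cotrace] : f -> f + swap (U f) is linear over 'F_2[G].  It is the
    trace from 'F_2[r] to 'F_2[G].  Its values on the basis 1, r, ..., r^5 are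
    0, 1, 1, 1, 1, 1, so that it maps into 'F_2[G].

    Let f be in K.  Then f + swap f = cotrace f is a polynomial c(G).  Applying
    [swap] gives c(G) = c(F), and since F and G vanish at r = 0 to different
    orders, c is a constant, which is 0 because f vanishes at 0
    ([comp_G_eq_comp_F]).  Hence f is fixed by [swap] and cotrace f = 0.

    Put D = r^2 + r = F + G.  An element of M(odd) fixed by [swap] is a
    polynomial in D with only odd exponents ([swap_invariant]).  Since
    D^6 = G D + G^2, such a polynomial is a combination, over 'F_2[G^2], of
    D, D^3, D^5, G, G D^2 and G D^4 ([odd_power_span]).  The map [cotrace] kills
    all of these but D^5, which it sends to G; as cotrace f = 0, the coefficient
    of D^5 is 0.  The five remaining elements lie in N2 ([N2_span]).

    For the statement about the f_n: the recursion defining the C_n says that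
    U + I sends (r^2 + r) r^(2n) to (r^2 + r) C_n(r^2) ([U_add_Modd]), whence
    p |-> (r^2 + r) p(r^2) carries ker phi into K. *)

(** * Characteristic two and the involution exchanging F and G *)

Lemma two0 : 2%:R = 0 :> F2X.
Proof. by rewrite F2X_dbl. Qed.

Lemma natF2 n : n%:R = (odd n)%:R :> F2X.
Proof.
by rewrite -[in LHS](odd_double_half n) natrD -muln2 natrM two0 mulr0 addr0.
Qed.

(** [ring] modulo 2.  An equation between constants is applied only to a
    coefficient equal to its left-hand side, so that there is one instance for
    each coefficient up to a bound that covers the uses below. *)
Ltac ring2 := ring:
  (natF2 2 : 2 = 0 :> F2X) (natF2 3 : 3 = 1 :> F2X)
  (natF2 4 : 4 = 0 :> F2X) (natF2 5 : 5 = 1 :> F2X)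
  (natF2 6 : 6 = 0 :> F2X) (natF2 7 : 7 = 1 :> F2X)
  (natF2 8 : 8 = 0 :> F2X) (natF2 9 : 9 = 1 :> F2X)
  (natF2 10 : 10 = 0 :> F2X) (natF2 11 : 11 = 1 :> F2X)
  (natF2 12 : 12 = 0 :> F2X) (natF2 13 : 13 = 1 :> F2X)
  (natF2 14 : 14 = 0 :> F2X) (natF2 15 : 15 = 1 :> F2X)
  (natF2 16 : 16 = 0 :> F2X) (natF2 17 : 17 = 1 :> F2X)
  (natF2 18 : 18 = 0 :> F2X) (natF2 19 : 19 = 1 :> F2X)
  (natF2 20 : 20 = 0 :> F2X) (natF2 21 : 21 = 1 :> F2X)
  (natF2 22 : 22 = 0 :> F2X) (natF2 23 : 23 = 1 :> F2X)
  (natF2 24 : 24 = 0 :> F2X).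

Lemma addff (p : F2X) : p + p = 0.
Proof. by rewrite -mulr2n F2X_dbl. Qed.

Lemma addf_eq0 (p q : F2X) : p + q = 0 -> p = q.
Proof. by move=> pq0; rewrite -[p]addr0 -(addff q) addrA pq0 add0r. Qed.

Lemma oppf (p : F2X) : - p = p.
Proof. by apply: addf_eq0; rewrite addNr. Qed.

Definition swap (p : F2X) : F2X := p \Po ('X + 1).

Lemma swapD p q : swap (p + q) = swap p + swap q.
Proof. exact: comp_polyD. Qed.

Lemma swapM p q : swap (p * q) = swap p * swap q.
Proof. exact: comp_polyM. Qed.

Lemma swapXn p n : swap (p ^+ n) = swap p ^+ n.
Proof. by elim: n => [|n IH]; [exact: comp_polyC | rewrite !exprS swapM IH]. Qed.

Lemma swap1 : swap 1 = 1.
Proof. by rewrite /swap comp_polyC. Qed.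

Lemma swapX : swap 'X = 'X + 1.
Proof. by rewrite /swap comp_polyX. Qed.

Lemma swapX1 : swap ('X + 1) = 'X.
Proof. by rewrite swapD swap1 swapX -addrA addff addr0. Qed.

Definition swapE := (swapD, swapM, swapXn, swap1, swapX).

Lemma swap_comp p q : swap (p \Po q) = p \Po swap q.
Proof. by rewrite /swap -comp_polyA. Qed.

Lemma swapK : involutive swap.
Proof.
move=> p; rewrite {1}/swap /swap -comp_polyA -/(swap ('X + 1)) swapX1.
by rewrite comp_polyXr.
Qed.

Lemma swapF : swap F = G.
Proof. by rewrite /F swapM swapXn swapX1 swapX mulrC. Qed.

Lemma swapG : swap G = F.
Proof. by rewrite -swapF swapK. Qed.

Definition D : F2X := 'X^2 + 'X.

Lemma size_D : size D = 3.
Proof. by rewrite /D size_polyDl ?size_polyXn ?size_polyX. Qed.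

Lemma D_neq0 : D != 0.
Proof. by rewrite -size_poly_gt0 size_D. Qed.

Lemma swap_D : swap D = D.
Proof. by rewrite /D !swapE; ring2. Qed.

Lemma addFG : F + G = D.
Proof. by rewrite /F /G /D; ring2. Qed.

Lemma mulFG : F * G = D ^+ 6.
Proof. by rewrite /F /G /D; ring. Qed.

Lemma D_sixth : D ^+ 6 = G * D + G ^+ 2.
Proof. by rewrite -mulFG -addFG; ring2. Qed.

(** * Polynomials fixed by the involution *)

(** The order of vanishing at 0 of c(G) is 5 times that of c, while for c(F) it
    equals that of c. *)
Lemma comp_G_eq_comp_F (c : F2X) : c \Po G = c \Po F -> c.[0] = 0 -> c = 0.
Proof.
case: (multiplicity_XsubC c 0) => m [q]; case: (eqVneq c 0) => //= _.
rewrite subr0 => nrq ->; case: m => [|m].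
  by rewrite expr0 mulr1 => _ /eqP; rewrite -/(root q 0) (negPf nrq).
rewrite !comp_polyM !(rmorphXn (comp_poly _)) /= !comp_polyX => eGF _.
have X0 : ('X : F2X) ^+ m.+1 != 0 by rewrite expf_neq0 ?polyX_eq0.
(* G = r * r^4 (r + 1) and F = r * (r + 1)^5: cancel the powers of r and
   evaluate at 0, where only the left-hand side still vanishes. *)
have e : ('X ^+ 4 * ('X + 1)) ^+ m.+1 * (q \Po G)
       = ('X + 1) ^+ 5 ^+ m.+1 * (q \Po F).
  apply: (mulfI X0); rewrite !mulrA -!exprMn -/F [RHS]mulrC -eGF [LHS]mulrC.
  by congr (_ * _ ^+ _); rewrite /G; ring.
move/(congr1 (fun p => p.[0])): e; rewrite !hornerM !horner_exp !horner_comp.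
rewrite /F /G !hornerE !expr1n /=.
rewrite exprS !(mul0r, expr0n) /= !mul1r => /esym /eqP.
by rewrite -/(root q 0) (negPf nrq).
Qed.

(** A polynomial fixed by [swap] takes the same value at 0 and 1; once that
    value is subtracted it is divisible by X (X + 1), and the quotient is again
    fixed. *)
Lemma swap_invariant (g : F2X) : swap g = g -> exists h, g = h \Po D.
Proof.
have [n] := ubnP (size g); elim: n g => // n IH g le_gn gw.
have /factor_theorem[q eq0] : root (g - g.[0]%:P) 0.
  by rewrite /root !hornerE subrr.
have /factor_theorem[k eq1] : root q 1.
  have : (swap g).[0] - g.[0] = 0 by rewrite gw subrr.
  have -> : (swap g).[0] = g.[1] by rewrite horner_comp !hornerE.
  have := congr1 (fun p => p.[1]) eq0; rewrite !hornerE subr0 mulr1 => ->.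
  by move/eqP.
have eg : g = k * D + g.[0]%:P.
  apply/eqP; rewrite -subr_eq eq0 eq1; apply/eqP.
  by rewrite /D polyC1 polyC0 !oppf; ring.
have [k0|k0] := eqVneq k 0.
  by exists g.[0]%:P; rewrite {1}eg k0 mul0r add0r comp_polyC.
have kw : swap k = k.
  apply: (mulIf D_neq0); rewrite -{1}swap_D -swapM.
  apply: (addIr g.[0]%:P); rewrite -eg -[in RHS]gw [in RHS]eg swapD.
  by rewrite [swap (g.[0]%:P)]comp_polyC.
have [h eh] : exists h, k = h \Po D.
  apply: IH kw; rewrite -ltnS; apply: leq_trans le_gn; rewrite ltnS.
  have sk : size (k * D) = (size k).+2.
    by rewrite size_mul ?D_neq0 // size_D addnC.
  by rewrite eg size_polyDl sk // size_polyC; case: (_ != 0).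
by exists (h * 'X + g.[0]%:P); rewrite comp_poly_MXaddC -eh.
Qed.

(** The span is stable under multiplication by D^2, which acts by
    D -> D^3 -> D^5 -> G D^2 + G^2 D and G -> G D^2 -> G D^4 -> G^2 D + G^2 G;
    the last steps use D^6 = G D + G^2. *)
Lemma odd_power_span (h : F2X) : exists a0 a1 a2 b0 b1 b2 : F2X,
  D * (h \Po D ^+ 2) =
    (a0 \Po G ^+ 2) * D + (a1 \Po G ^+ 2) * D ^+ 3 + (a2 \Po G ^+ 2) * D ^+ 5
  + (b0 \Po G ^+ 2) * G + (b1 \Po G ^+ 2) * (G * D ^+ 2)
  + (b2 \Po G ^+ 2) * (G * D ^+ 4).
Proof.
elim/poly_ind: h => [|h c [a0 [a1 [a2 [b0 [b1 [b2 IH]]]]]]].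
  by exists 0, 0, 0, 0, 0, 0; rewrite !comp_poly0 mulr0 !mul0r !addr0.
exists ((a2 + b2) * 'X + c%:P), a0, a1, (b2 * 'X), (a2 + b0), b1.
rewrite !comp_poly_MXaddC !comp_polyM !comp_polyD comp_polyX.
rewrite mulrDr mulrA IH.
by ring: D_sixth.
Qed.

(** * The 'F_2[G]-linear map f + swap (U f) *)

Section OperatorU.

Variables (U : {linear F2X -> F2X}) (hU : is_U U).

Definition cotrace (f : F2X) : F2X := f + swap (U f).

Lemma cotrace0 : cotrace 0 = 0.
Proof. by rewrite /cotrace linear0 add0r /swap comp_poly0. Qed.

Lemma cotraceD f g : cotrace (f + g) = cotrace f + cotrace g.
Proof. by rewrite /cotrace linearD swapD addrACA. Qed.

Lemma cotraceZ a f : cotrace (a *: f) = a *: cotrace f.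
Proof. by rewrite /cotrace linearZ scalerDr /= /swap comp_polyZ. Qed.

Lemma cotraceG f : cotrace (G * f) = G * cotrace f.
Proof. by case: hU => UG _; rewrite /cotrace UG swapM swapF mulrDr. Qed.

Lemma cotrace_compG c f : cotrace ((c \Po G) * f) = (c \Po G) * cotrace f.
Proof.
elim/poly_ind: c => [|c a IH].
  by rewrite comp_poly0 !mul0r cotrace0.
rewrite comp_poly_MXaddC !mulrDl cotraceD !mul_polyC cotraceZ.
by rewrite mulrAC [_ * G]mulrC cotraceG IH; congr (_ + _); ring.
Qed.

Lemma cotrace_compG2 c f :
  cotrace ((c \Po G ^+ 2) * f) = (c \Po G ^+ 2) * cotrace f.
Proof.
have -> : G ^+ 2 = 'X^2 \Po G by rewrite comp_Xn_poly.
by rewrite comp_polyA cotrace_compG.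
Qed.

Lemma cotrace_low :
  [/\ cotrace 1 = 0, cotrace 'X = 1 & cotrace 'X^2 = 1] /\
  [/\ cotrace 'X^3 = 1, cotrace 'X^4 = 1 & cotrace 'X^5 = 1].
Proof.
case: hU => _ [[U0 U1 U2] [U3 U4 U5]].
by split; split; rewrite /cotrace ?U0 ?U1 ?U2 ?U3 ?U4 ?U5 !swapE; ring2.
Qed.

(** The six values above are constants, and r^(n+6) = G r^n + r^(n+5) carries
    membership in 'F_2[G] to all higher powers of r. *)
Lemma cotrace_in_compG f : exists c, cotrace f = c \Po G.
Proof.
have [[T0 T1 T2] [T3 T4 T5]] := cotrace_low.
have low k : cotrace 'X^k = 1 -> exists c, cotrace 'X^k = c \Po G.
  by move=> ->; exists 1; rewrite comp_polyC.
have TX n : exists c, cotrace 'X^n = c \Po G.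
  elim/ltn_ind: n; do 6?[case; first by move=> _; first
    [exists 0; rewrite expr0 T0 comp_poly0 | apply: low]].
  move=> n IH; have -> : 'X^(n.+4.+2) = G * 'X^n + 'X^(n.+4.+1) :> F2X.
    by rewrite GXn -addrA addff addr0.
  have [c ec] := IH n (leq_addl 5 n); have [d ed] := IH _ (leqnn n.+4.+2).
  exists (c * 'X + d).
  by rewrite cotraceD cotraceG ec ed comp_polyD comp_polyM comp_polyX mulrC.
rewrite -(coefK f) poly_def; elim/big_ind: _ => [|p q [c ep] [d eq]|i _].
- by exists 0; rewrite cotrace0 comp_poly0.
- by exists (c + d); rewrite cotraceD ep eq comp_polyD.
- have [c ec] := TX i.
  by exists (f`_i *: c); rewrite cotraceZ ec comp_polyZ.
Qed.

(** * The kernel of U + I lies in N2 *)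

(** For f in K the polynomial cotrace f = f + swap f is fixed by [swap] and lies
    in 'F_2[G], hence also in 'F_2[F]; the intersection of the two rings contains
    only constants, and this one vanishes at 0. *)
Lemma K_swap_cotrace f : K U f -> swap f = f /\ cotrace f = 0.
Proof.
case=> [[g ef] /addf_eq0 Uf].
have [c ec] := cotrace_in_compG f.
have eT : cotrace f = f + swap f by rewrite /cotrace Uf.
have Tw : swap (cotrace f) = cotrace f by rewrite eT swapD swapK addrC.
suff c0 : c = 0.
  have T0 : cotrace f = 0 by rewrite ec c0 comp_poly0.
  by split=> //; apply/esym/addf_eq0; rewrite -eT.
apply: comp_G_eq_comp_F.
  by rewrite -ec -Tw ec swap_comp swapG.
have G0 : G.[0] = 0 by rewrite /G !hornerE expr0n.
rewrite -G0 -horner_comp -ec eT ef /swap.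
(* f vanishes at 0 and at 1 because r^2 + r does. *)
by rewrite hornerD horner_comp !hornerM !hornerE; apply/val_inj.
Qed.

Lemma cotrace_D_powers :
  [/\ cotrace D = 0, cotrace (D ^+ 3) = 0 & cotrace (D ^+ 5) = G] /\
  [/\ cotrace 1 = 0, cotrace (D ^+ 2) = 0 & cotrace (D ^+ 4) = 0].
Proof.
have [[T0 T1 T2] [T3 T4 T5]] := cotrace_low.
have e2 : D ^+ 2 = 'X^4 + 'X^2 by rewrite /D; ring2.
have e3 : D ^+ 3 = G * 1 + 'X^4 + 'X^3 by rewrite /D /G; ring2.
have e4 : D ^+ 4 = G * 'X^2 + G * 'X + G * 1 + 'X^5 + 'X^4.
  by rewrite /D /G; ring2.
have e5 : D ^+ 5 = G * 'X^4 + G * 1 by rewrite /D /G; ring2.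
by split; split; rewrite ?(e2, e3, e4, e5) /D ?(cotraceD, cotraceG)
  ?(T0, T1, T2, T3, T4, T5); ring2.
Qed.

(** D^3 = u1 + u2, and G D^4 = u5 + u4 + G^2 u0 because
    (F + G) F G = D^7 = G D^2 + G^2 D. *)
Lemma N2_span a0 a1 b0 b1 b2 :
  N2 ((a0 \Po G ^+ 2) * D + (a1 \Po G ^+ 2) * D ^+ 3
    + (b0 \Po G ^+ 2) * G + (b1 \Po G ^+ 2) * (G * D ^+ 2)
    + (b2 \Po G ^+ 2) * (G * D ^+ 4)).
Proof.
exists (a0 + b2 * 'X), a1, (a1 + b0), (b1 + b2), b2.
have -> : u5 = D ^+ 4 * G + D ^+ 7 by rewrite /u5 addFG -mulrA mulFG -exprS.
rewrite /u0 /u1 /u2 /u4 addFG !comp_polyD comp_polyM comp_polyX.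
by ring: two0 D_sixth.
Qed.

Lemma K_sub_N2 f : K U f -> N2 f.
Proof.
move=> Kf; have [fw Tf] := K_swap_cotrace Kf; case: Kf => [[g ef] _].
(* As D is fixed by [swap], cancelling it shows that g(r^2) is fixed, and
   r -> r + 1 acts on r^2 = t as t -> t + 1. *)
have gw : swap g = g.
  apply/eqP; rewrite -subr_eq0 -(comp_poly_eq0 _ (q := 'X^2)) ?size_polyXn //.
  rewrite comp_polyB subr_eq0; apply/eqP; apply: (mulfI D_neq0).
  rewrite -ef -fw ef swapM -/D swap_D; congr (_ * _).
  rewrite swap_comp /swap -comp_polyA; congr (_ \Po _).
  by rewrite comp_Xn_poly comp_polyD comp_polyX comp_polyC; ring2.
have [h eg] := swap_invariant gw.
have {}ef : f = D * (h \Po D ^+ 2).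
  rewrite ef eg -comp_polyA; congr (_ * (_ \Po _)).
  by rewrite /D comp_polyD comp_Xn_poly comp_polyX; ring2.
have [a0 [a1 [a2 [b0 [b1 [b2]]]]]] := odd_power_span h; rewrite -ef => fE.
have [[TD TD3 TD5] [T1 TD2 TD4]] := cotrace_D_powers.
have G0 : G != 0.
  by rewrite mulf_neq0 ?expf_neq0 ?polyX_eq0 // -polyC1 monic_neq0 ?monicXaddC.
have TG : cotrace G = 0 by rewrite -[G]mulr1 cotraceG T1 mulr0.
have a20 : a2 \Po G ^+ 2 = 0.
  apply: (mulIf G0); rewrite mul0r -Tf fE.
  rewrite !cotraceD !cotrace_compG2 !cotraceG TD TD3 TD5 TG TD2 TD4.
  by rewrite !mulr0 !addr0 add0r.
by rewrite fE a20 mul0r addr0; apply: N2_span.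
Qed.

(** * U + I on M(odd) and the recursion of the C_n *)

(** With t = r^2, one has G^2 = t^6 + t^5, F^2 = t^6 + t^5 + t^2 + t and
    F^2 + G^2 = t^2 + t.  With e_n = (r^2 + r) t^n, applying U to
    e_(n+6) + e_(n+5) = G^2 e_n therefore gives the recursion of the C_n. *)
Lemma U_add_Modd_Xn n :
  U (D * 'X^2 ^+ n) + D * 'X^2 ^+ n = D * (C n \Po 'X^2).
Proof.
case: hU => UG [[U0 U1 U2] [U3 U4 U5]].
have FE : F = 'X^6 + 'X^5 + 'X^2 + 'X by rewrite /F; ring2.
have UX k : U 'X^(k.+4.+2) = U 'X^(k.+4.+1) + F * U 'X^k.
  by apply: addf_eq0; rewrite -UG GXn linearD /=; ring2.
have base k : U (D * 'X^2 ^+ k) = U 'X^(k.*2.+2) + U 'X^(k.*2.+1).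
  by rewrite -linearD; congr (U _); rewrite /D -exprM mul2n !exprS; ring.
elim/ltn_ind: n => n IH.
have [lt_n6|] := ltnP n 6.
  rewrite base; case: n lt_n6 {IH} => [|[|[|[|[|[|//]]]]]] _ /=;
    rewrite ?UX ?expr0 ?expr1 ?U0 ?(U1, U2, U3, U4, U5) ?comp_poly0;
    by rewrite ?comp_polyD ?comp_polyC ?comp_Xn_poly ?comp_polyX ?FE /D; ring2.
case: n IH => [|[|[|[|[|[|n]]]]]] // IH _.
(* e_(n+6) = e_(n+5) + G^2 e_n, because G^2 = t^6 + t^5. *)
have split6 : D * 'X^2 ^+ n.+4.+2
    = D * 'X^2 ^+ n.+4.+1 + G * (G * (D * 'X^2 ^+ n)).
  by rewrite /G -[n.+4.+2]/(6 + n)%N -[n.+4.+1]/(5 + n)%N !exprD; ring2.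
have e0 := IH n (leq_addl 5 n); have e5 := IH n.+4.+1 (leqnn n.+4.+2).
have {}e0 : U (D * 'X^2 ^+ n) = D * (C n \Po 'X^2) + D * 'X^2 ^+ n.
  by rewrite -e0 -addrA addff addr0.
have {}e5 : U (D * 'X^2 ^+ n.+4.+1)
    = D * (C n.+4.+1 \Po 'X^2) + D * 'X^2 ^+ n.+4.+1.
  by rewrite -e5 -addrA addff addr0.
rewrite {1}split6 linearD !UG e0 e5.
have -> : C n.+4.+2
    = C n.+4.+1 + ('X^6 + 'X^5 + 'X^2 + 'X) * C n + 'X^n * ('X^2 + 'X) by [].
rewrite !(comp_polyD, comp_polyM, comp_Xn_poly, comp_polyX) FE.
rewrite -[n.+4.+2]/(6 + n)%N -[n.+4.+1]/(5 + n)%N !exprD.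
by ring2.
Qed.

Lemma U_add_Modd p :
  U (D * (p \Po 'X^2)) + D * (p \Po 'X^2) = D * (phi p \Po 'X^2).
Proof.
rewrite -(coefK p) poly_def; elim/big_ind: _ => [|q r IHq IHr|i _].
- by rewrite !(linear0, comp_poly0, mulr0) addr0.
- have -> : phi (q + r) = phi q + phi r by exact: linearD.
  by rewrite !comp_polyD !mulrDr -IHq -IHr linearD addrACA.
- have -> : phi (p`_i *: 'X^i) = p`_i *: C i by rewrite -phiXn; exact: linearZ.
  rewrite !comp_polyZ comp_Xn_poly -!scalerAr linearZ /=.
  by rewrite -scalerDr U_add_Modd_Xn.
Qed.

End OperatorU.

Theorem theorem4p3 (U : {linear {poly 'F_2} -> {poly 'F_2}}) (hU : is_U U) :
  (forall f : {poly 'F_2}, K U f -> N2 f) /\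
  (forall g : nat -> {poly 'F_2},
     (forall n : nat, idx02 n -> size (g n) = n.+1) ->
     is_basis idx02 g (fun p => phi p = 0) ->
     forall n : nat, idx02 n -> N2 (('X^2 + 'X) * (g n \Po 'X^2))).
Proof.
split=> [f|g _ [phi_g _ _] n n02]; first exact: K_sub_N2.
apply: (K_sub_N2 hU); split; first by exists (g n).
by rewrite -/D (U_add_Modd hU) phi_g // comp_poly0 mulr0.
Qed.
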